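(* Let $(A,\Delta)$ be a left multiplier Hopf algebra with counit $\varepsilon$, and let $S,S':A\to L(A)$ be the maps defined by $S(a)b=(\varepsilon\otimes\iota)T_1^{-1}(a\otimes b)$ and $S'(a)c=(\iota\otimes\varepsilon)T_4^{-1}(c\otimes a)$. Then for all $a,b,c\in A$, $$\sum_{(a)}S(a_{(1)})a_{(2)}b=\varepsilon(a)b\qquad\text{and}\qquad\sum_{(a)}S'(a_{(2)})a_{(1)}c=\varepsilon(a)c.$$
   Context: Algebras are associative algebras over $\mathbb C$, not necessarily unital, and $A$ is non-degenerate: if $ab=0$ for all $b\in A$ then $a=0$, and if $ab=0$ for all $a\in A$ then $b=0$. $M(A\otimes A)$ denotes the multiplier algebra of $A\otimes A$, $\iota$ the identity map, $m:A\otimes A\to A$ the multiplication. $L(A)$ is the algebra of left multipliers of $A$, i.e. linear maps $x:A\to A$, $a\mapsto xa$, with $x(ab)=(xa)b$. A left multiplier Hopf algebra is a pair $(A,\Delta)$ where $A$ is a non-degenerate algebra and $\Delta:A\to M(A\otimes A)$ is a homomorphism such that: the maps $T_1(a\otimes b)=\Delta(a)(1\otimes b)$ and $T_4(c\otimes a)=\Delta(a)(c\otimes 1)$ have range in $A\otimes A$; $\Delta$ is coassociative, i.e. $((\Delta\otimes\iota)(\Delta(a)(1\otimes b)))(c\otimes 1\otimes 1)=((\iota\otimes\Delta)(\Delta(a)(c\otimes 1)))(1\otimes 1\otimes b)$ for all $a,b,c\in A$; and $T_1$, $T_4$ are bijections from $A\otimes A$ to itself. The counit $\varepsilon:A\to\mathbb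 C$ is the linear map determined by $\varepsilon(a)b=m(T_1^{-1}(a\otimes b))$ for all $a,b\in A$; it satisfies $(\iota\otimes\varepsilon)(\Delta(a)(c\otimes 1))=ac$ and $(\varepsilon\otimes\iota)(\Delta(a)(1\otimes b))=ab$. Sweedler notation: $\Delta(a)(1\otimes b)=\sum_{(a)}a_{(1)}\otimes a_{(2)}b$ and $\Delta(a)(c\otimes 1)=\sum_{(a)}a_{(1)}c\otimes a_{(2)}$, both in $A\otimes A$. So $\sum_{(a)}S(a_{(1)})a_{(2)}b$ means $\sum_i S(p_i)q_i$ where $\Delta(a)(1\otimes b)=\sum_i p_i\otimes q_i$, and $\sum_{(a)}S'(a_{(2)})a_{(1)}c$ means $\sum_i S'(q_i)p_i$ where $\Delta(a)(c\otimes 1)=\sum_i p_i\otimes q_i$. *)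

(* Defs.v *)
From HB Require Import structures.
From mathcomp Require Import all_boot all_algebra.
From mathcomp Require Import boolp classical_sets functions.
From mathcomp Require Import freeg.

Set Implicit Arguments.
Unset Strict Implicit.
Unset Printing Implicit Defensive.

Import GRing.Theory.
Local Open Scope ring_scope.
Local Open Scope quotient_scope.
Local Open Scope classical_set_scope.

Reserved Notation "x ** y" (at level 40, left associativity).
Reserved Notation "u \ox v" (at level 40, left associativity).

(* Algebras over K, associative but not necessarily unital. *)
HB.mixin Record Lmodule_isNonUnitalAlgebra (K : fieldType) A
    of GRing.Lmodule K A := {
  nmul : A -> A -> A;
  nmulA : associative nmul;
  nmul_bilinear : bilinear_for *:%R *:%R nmul
}.

#[short(type="nualgType")]
HB.structure Definition NonUnitalAlgebra (K : fieldType) :=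
  {A of GRing.Lmodule K A & Lmodule_isNonUnitalAlgebra K A}.

Notation "x ** y" := (nmul x y) : ring_scope.

HB.instance Definition _ (K : fieldType) (A : nualgType K) :=
  bilinear_isBilinear.Build K A A A *:%R *:%R (@nmul K A) nmul_bilinear.

Section Multiplications.
Variables (K : fieldType) (A : nualgType K).
Implicit Types a x : A.

Definition lmul a x := a ** x.
Definition rmul a x := x ** a.

Lemma lmulE a x : lmul a x = a ** x. Proof. by []. Qed.
Lemma rmulE a x : rmul a x = x ** a. Proof. by []. Qed.

Lemma nmulDl a b c : (a + b) ** c = a ** c + b ** c.
Proof. exact: linearDl. Qed.
Lemma nmulDr a b c : a ** (b + c) = a ** b + a ** c.
Proof. exact: linearDr. Qed.

Fact lmul_linear a : linear (lmul a).
Proof. exact: nmul_bilinear.2. Qed.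
HB.instance Definition _ a :=
  GRing.isLinear.Build K A A *:%R (lmul a) (lmul_linear a).

Fact rmul_linear a : linear (rmul a).
Proof. exact: nmul_bilinear.1. Qed.
HB.instance Definition _ a :=
  GRing.isLinear.Build K A A *:%R (rmul a) (rmul_linear a).

End Multiplications.

Definition nondegenerate (K : fieldType) (A : nualgType K) : Prop :=
  (forall a : A, (forall b, a ** b = 0) -> a = 0) /\
  (forall b : A, (forall a, a ** b = 0) -> b = 0).

(* The tensor product of U and V: the free module on U * V modulo the
   submodule generated by the bilinearity relations. *)
Section TensorProduct.
Variables (K : fieldType) (U V : lmodType K).

Local Notation F := {freeg (U * V)%type / K}.
Local Notation gen u v := (<< (u, v) >> : F).

Definition tens_relations : set F :=
  [set D | exists (a : K) (u u' : U) (v : V),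
     D = gen (a *: u + u') v - (a *: gen u v + gen u' v)] `|`
  [set D | exists (a : K) (u : U) (v v' : V),
     D = gen u (a *: v + v') - (a *: gen u v + gen u v')].

Definition tens_null : {pred F} := fun D =>
  `[< forall S : {pred F}, submod_closed S ->
        (forall E, tens_relations E -> E \in S) -> D \in S >].

Lemma tens_null_closed : submod_closed tens_null.
Proof.
split; first by apply/asboolP => S [].
move=> a x y /asboolP xN /asboolP yN; apply/asboolP => S Ssub gS.
by apply: Ssub.2; [apply: xN | apply: yN].
Qed.

HB.instance Definition _ :=
  GRing.isSubmodClosed.Build K F tens_null tens_null_closed.

Definition tens := Quotient.quot tens_null.
HB.instance Definition _ := GRing.Zmodule.on tens.

Definition tens_pi (D : F) : tens := \pi_(Quotient.quot tens_null) D.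

Lemma tens_pi_eq D E : (tens_pi D = tens_pi E) <-> D - E \in tens_null.
Proof.
by rewrite /tens_pi Quotient.idealrBE; split=> [->|/eqP].
Qed.

Lemma tens_piK (t : tens) : tens_pi (repr t) = t.
Proof. exact: reprK. Qed.

Lemma tens_piD D E : tens_pi (D + E) = tens_pi D + tens_pi E.
Proof. exact: raddfD. Qed.

Definition tens_scale (a : K) (t : tens) : tens := tens_pi (a *: repr t).

Lemma tens_piZ a D : tens_pi (a *: D) = tens_scale a (tens_pi D).
Proof.
apply/tens_pi_eq; rewrite -scalerBr rpredZ //.
by apply/tens_pi_eq; rewrite tens_piK.
Qed.

Fact tens_scaleA a b t : tens_scale a (tens_scale b t) = tens_scale (a * b) t.
Proof. by rewrite -[t]tens_piK -!tens_piZ scalerA. Qed.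
Fact tens_scale1 : left_id 1 tens_scale.
Proof. by move=> t; rewrite -[t]tens_piK -tens_piZ scale1r. Qed.
Fact tens_scaleDr : right_distributive tens_scale +%R.
Proof.
move=> a s t; rewrite -[s]tens_piK -[t]tens_piK.
by rewrite -tens_piD -!tens_piZ -tens_piD scalerDr.
Qed.
Fact tens_scaleDl t : {morph tens_scale^~ t : a b / a + b}.
Proof. by move=> a b; rewrite -[t]tens_piK -!tens_piZ -tens_piD scalerDl. Qed.

HB.instance Definition _ := GRing.Zmodule_isLmodule.Build K tens
  tens_scaleA tens_scale1 tens_scaleDr tens_scaleDl.

Fact tens_pi_linear : linear tens_pi.
Proof. by move=> a D E; rewrite tens_piD tens_piZ. Qed.
HB.instance Definition _ := GRing.isLinear.Build K F tens *:%R tens_pi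
  tens_pi_linear.

Definition pure (u : U) (v : V) : tens := tens_pi (gen u v).

Fact pure_bilinear : bilinear_for *:%R *:%R pure.
Proof.
split=> [v|u] a x y; rewrite /pure -linearP; apply/tens_pi_eq;
  apply/asboolP => S _ gS; apply: gS; [left|right].
  by exists a, x, y, v.
by exists a, u, x, y.
Qed.
HB.instance Definition _ :=
  bilinear_isBilinear.Build K U V tens *:%R *:%R pure pure_bilinear.

End TensorProduct.

Notation "u \ox v" := (pure u v) : ring_scope.

Section TensorLift.
Variables (K : fieldType) (U V W : lmodType K).

(* The linear map sending u \ox v to f u v. *)
Definition tlift (f : {bilinear U -> V -> W}) (t : tens U V) : W :=
  fglift (fun x => f x.1 x.2) (repr t).

Variable f : {bilinear U -> V -> W}.

Let g (x : U * V) : W := f x.1 x.2.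

Let g_additive D E : fglift g (D - E) = fglift g D - fglift g E.
Proof. exact: lift_is_additive. Qed.

Let g_sum (I : Type) (r : seq I) (D : I -> {freeg (U * V)%type / K}) :
  fglift g (\sum_(i <- r) D i) = \sum_(i <- r) fglift g (D i).
Proof.
pose G : {additive {freeg (U * V)%type / K} -> W} :=
  HB.pack (fglift g) (GRing.isZmodMorphism.Build _ _ (fglift g) g_additive).
exact: (raddf_sum G).
Qed.

Let g_linear : linear (fglift g).
Proof.
have gN D : fglift g (- D) = - fglift g D.
  have g0 : fglift g 0 = 0 by rewrite -(subr0 0) g_additive subrr.
  by rewrite -sub0r g_additive g0 sub0r.
move=> a D E; rewrite -[E in LHS]opprK g_additive gN opprK; congr (_ + _).
have -> : a *: D = \sum_(x <- dom D) << a * coeff x D *g x >> by [].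
rewrite -{3}[D]freeg_sumE !g_sum scaler_sumr.
by apply: eq_bigr => x _; rewrite !liftU scalerA.
Qed.

Lemma tlift_pi D : tlift f (tens_pi D) = fglift g D.
Proof.
have g0 : fglift g 0 = 0 by rewrite -(subr0 0) g_additive subrr.
pose S : {pred {freeg (U * V)%type / K}} := [pred E | fglift g E == 0].
have Ssub : submod_closed S.
  split; first by rewrite inE g0.
  by move=> a x y; rewrite !inE g_linear => /eqP-> /eqP->; rewrite scaler0 addr0.
suff : repr (tens_pi D) - D \in S.
  by rewrite inE g_additive subr_eq0 => /eqP.
have /tens_pi_eq/asboolP := tens_piK (tens_pi D); apply => //.
move=> E [[a [u [u' [v ->]]]]|[a [u [v [v' ->]]]]]; rewrite inE g_additive;
  by rewrite g_linear !liftU !scale1r /g /= ?linearPl ?linearPr subrr.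
Qed.

Fact tlift_linear : linear (tlift f).
Proof.
move=> a s t; rewrite -[s]tens_piK -[t]tens_piK -linearP !tlift_pi.
exact: g_linear.
Qed.
HB.instance Definition _ :=
  GRing.isLinear.Build K (tens U V) W *:%R (tlift f) tlift_linear.

Lemma tlift_pure u v : tlift f (u \ox v) = f u v.
Proof. by rewrite tlift_pi liftU scale1r. Qed.

End TensorLift.

Section TensorTheory.
Variables (K : fieldType).

Lemma tens_sum (U V : lmodType K) (t : tens U V) :
  exists n (p : 'I_n -> U) (q : 'I_n -> V), t = \sum_(i < n) p i \ox q i.
Proof.
rewrite -[t]tens_piK; set D := repr t.
exists (size (dom D)), (fun i => coeff (tnth (in_tuple (dom D)) i) D *:
    (tnth (in_tuple (dom D)) i).1), (fun i => (tnth (in_tuple (dom D)) i).2).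
rewrite -{1}[D]freeg_sumE big_tnth linear_sum; apply: eq_bigr => i _ /=.
rewrite linearZl_LR /=; set x := tnth _ i.
rewrite /pure -linearZ /=; congr tens_pi.
apply/eqP/freeg_eqP => y; rewrite coeffZ !coeffU mul1r.
by case: x.
Qed.

Lemma tensW (U V : lmodType K) (P : tens U V -> Prop) :
  (forall u v, P (u \ox v)) -> (forall s t, P s -> P t -> P (s + t)) ->
  forall t, P t.
Proof.
move=> Pp PD t; have [n [p [q ->]]] := tens_sum t.
elim/big_ind: _ => //.
by have <- : (0 : U) \ox (0 : V) = 0 by rewrite linear0r.
Qed.

Lemma tens_ext (U V W : lmodType K) (f g : {linear tens U V -> W}) :
  (forall u v, f (u \ox v) = g (u \ox v)) -> f =1 g.
Proof.
by move=> fg; apply: tensW => // s t fs ft; rewrite !linearD fs ft.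
Qed.

Lemma functional_separation (V : lmodType K) (v : V) :
  (forall phi : {scalar V}, phi v = 0) -> v = 0.
Proof.
move=> phiv; apply: contrapT => v0.
pose P (W : set V) :=
  (forall a x y, W x -> W y -> W (a *: x + y)) /\ ~ W v.
have chainP (F : set (set V)) : F `<=` P -> total_on F subset ->
    P (\bigcup_(X in F) X).
  move=> FP totF; split; last by move=> [X FX Xv]; case: (FP _ FX).
  move=> a x y [X FX Xx] [Y FY Yy]; have [XY|YX] := totF _ _ FX FY.
    by exists Y => //; apply: (FP _ FY).1 => //; apply: XY.
  by exists X => //; apply: (FP _ FX).1 => //; apply: YX.
have [W [[Wlin Wv] Wmax]] := Zorn_bigcup chainP.
have W0 : W 0.
  apply: contrapT => nW0; apply: (Wmax [set 0]).
    split; last by move=> /(_ 0 erefl).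
    by move=> x Wx; case: nW0; rewrite -(addNr x) -scaleN1r; apply: Wlin.
  split; last by move=> /= ve; apply: v0.
  by move=> a x y /= -> ->; rewrite scaler0 addr0.
have WZ a x : W x -> W (a *: x) by move=> Wx; rewrite -[_ *: _]addr0; apply: Wlin.
have WD x y : W x -> W y -> W (x + y).
  by move=> Wx Wy; rewrite -[x]scale1r; apply: Wlin.
have ex u : exists k, W (u - k *: v).
  apply: contrapT => nex.
  have Wu : ~ W u by move=> Wu; apply: nex; exists 0; rewrite scale0r subr0.
  apply: (Wmax [set y | exists k, W (y - k *: u)]).
    split; last by move=> /(_ u); apply: contra_not Wu; apply; exists 1;
      rewrite scale1r subrr.
    by move=> x Wx; exists 0; rewrite scale0r subr0.
  split=> [a x y [k Wk] [l Wl]|[k Wk]].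
    exists (a * k + l); rewrite scalerDl -scalerA opprD addrACA -scalerBr.
    exact: Wlin.
  have [k0|k0] := eqVneq k 0; first by apply: Wv; rewrite k0 scale0r subr0 in Wk.
  apply: nex; exists k^-1; rewrite -[u](scalerK k0) -scalerBr -opprB -scaleN1r.
  exact: (WZ _ _ (WZ _ _ Wk)).
have uniq u k l : W (u - k *: v) -> W (u - l *: v) -> k = l.
  move=> Wk Wl; apply/eqP; rewrite -subr_eq0; apply: contraPT Wv => kl; apply.
  rewrite -[v](scalerK kl) scalerBl; apply: WZ.
  have -> : k *: v - l *: v = (-1) *: (u - k *: v) + (u - l *: v).
    by rewrite scaleN1r opprB addrA subrK.
  exact: Wlin.
pose phi u : K := xget 0 [set k | W (u - k *: v)].
have phiP u : W (u - phi u *: v).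
  exact: (@xgetPex K 0 (fun k => W (u - k *: v)) (ex u)).
have phi_lin : linear_for *%R phi.
  move=> a x y; apply: (@uniq (a *: x + y)); first exact: phiP.
  rewrite scalerDl -scalerA opprD addrACA -scalerBr; exact: Wlin.
pose Phi : {scalar V} :=
  HB.pack phi (GRing.isLinear.Build K V K *%R phi phi_lin).
have phi1 : phi v = 1 by apply: (@uniq v) => //; rewrite scale1r subrr.
by have /eqP := phiv Phi; rewrite /= phi1 oner_eq0.
Qed.

End TensorTheory.

Section Slices.
Variables (K : fieldType) (U V : lmodType K).

Definition scale_left (phi : {scalar U}) (u : U) (v : V) : V := phi u *: v.
Definition scale_right (phi : {scalar V}) (u : U) (v : V) : U := phi v *: u.

Fact scale_left_bilinear phi : bilinear_for *:%R *:%R (scale_left phi).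
Proof.
split=> [v|u] a x y; rewrite /scale_left /= ?linearP /=.
  by rewrite scalerDl scalerA.
by rewrite !scalerA mulrC.
Qed.
HB.instance Definition _ phi := bilinear_isBilinear.Build K U V V *:%R *:%R
  (scale_left phi) (scale_left_bilinear phi).

Fact scale_right_bilinear phi : bilinear_for *:%R *:%R (scale_right phi).
Proof.
split=> [v|u] a x y; rewrite /scale_right /= ?linearP /=.
  by rewrite !scalerA mulrC.
by rewrite scalerDl scalerA.
Qed.
HB.instance Definition _ phi := bilinear_isBilinear.Build K U V U *:%R *:%R
  (scale_right phi) (scale_right_bilinear phi).

(* The maps phi (x) id and id (x) phi. *)
Definition slice_left (phi : {scalar U}) : {linear tens U V -> V} :=
  tlift (scale_left phi).
Definition slice_right (phi : {scalar V}) : {linear tens U V -> U} :=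
  tlift (scale_right phi).

Lemma slice_left_pure phi u v : slice_left phi (u \ox v) = phi u *: v.
Proof. exact: tlift_pure. Qed.

Lemma slice_right_pure phi u v : slice_right phi (u \ox v) = phi v *: u.
Proof. exact: tlift_pure. Qed.

Lemma slice_separation (t : tens U V) :
  (forall phi, slice_right phi t = 0) -> t = 0.
Proof.
have [n [p [q ->]]] := tens_sum t; elim: n p q => [|n IHn] p q sep.
  by rewrite big_ord0.
have [q0|/eqP q0] := eqVneq (q ord0) 0.
  move: sep; rewrite big_ord_recl q0 linear0r add0r; exact: IHn.
have [phi phi1] : exists phi : {scalar V}, phi (q ord0) = 1.
  apply: contrapT => nphi; apply/q0/functional_separation => phi.
  apply/eqP; apply: contraPT nphi => phi0; apply.
  pose psi v := (phi (q ord0))^-1 * phi v.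
  have psi_lin : linear_for *%R psi.
    by move=> a x y; rewrite /psi linearP mulrDr mulrCA.
  pose Psi : {scalar V} :=
    HB.pack psi (GRing.isLinear.Build K V K *%R psi psi_lin).
  by exists Psi; rewrite /= /psi mulVf.
have p0 : p ord0 = - \sum_(i < n) phi (q (fintype.lift ord0 i)) *: p (fintype.lift ord0 i).
  have := sep phi; rewrite linear_sum big_ord_recl slice_right_pure phi1 scale1r.
  move/eqP; rewrite addr_eq0 => /eqP->; congr (- _).
  by apply: eq_bigr => i _; rewrite slice_right_pure.
have E : \sum_(i < n.+1) p i \ox q i = \sum_(i < n)
    p (fintype.lift ord0 i) \ox (q (fintype.lift ord0 i) - phi (q (fintype.lift ord0 i)) *: q ord0).
  rewrite big_ord_recl p0 linearNl linear_sumlz -sumrN -big_split /=.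
  apply: eq_bigr => i _.
  by rewrite linearBr linearZl_LR linearZr_LR addrC.
by rewrite E; apply: IHn => phi'; rewrite -E; apply: sep.
Qed.

End Slices.
Arguments slice_left {K U V} phi.
Arguments slice_right {K U V} phi.

Section TensorMap.
Variables (K : fieldType) (U U' V V' : lmodType K).

Definition pure_map (f : {linear U -> U'}) (g : {linear V -> V'}) u v :
  tens U' V' := f u \ox g v.

Fact pure_map_bilinear f g : bilinear_for *:%R *:%R (pure_map f g).
Proof.
by split=> [v|u] a x y; rewrite /pure_map linearP ?linearPl ?linearPr.
Qed.
HB.instance Definition _ f g := bilinear_isBilinear.Build K U V (tens U' V')
  *:%R *:%R (pure_map f g) (pure_map_bilinear f g).

(* The map f (x) g. *)
Definition tmap (f : {linear U -> U'}) (g : {linear V -> V'}) :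
  {linear tens U V -> tens U' V'} := tlift (pure_map f g).

Lemma tmapD f g s t : tmap f g (s + t) = tmap f g s + tmap f g t.
Proof. exact: linearD. Qed.

Lemma tmap_pure f g u v : tmap f g (u \ox v) = f u \ox g v.
Proof. exact: tlift_pure. Qed.

End TensorMap.

Section Associator.
Variables (K : fieldType) (U V W : lmodType K).

Definition cons_right (w : W) (u : U) (v : V) : tens U (tens V W) :=
  u \ox (v \ox w).

Fact cons_right_bilinear w : bilinear_for *:%R *:%R (cons_right w).
Proof.
by split=> [v|u] a x y; rewrite /cons_right ?linearPl ?linearPr.
Qed.
HB.instance Definition _ w := bilinear_isBilinear.Build K U V
  (tens U (tens V W)) *:%R *:%R (cons_right w) (cons_right_bilinear w).

Definition reassoc (t : tens U V) (w : W) : tens U (tens V W) :=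
  tlift (cons_right w) t.

Fact reassoc_bilinear : bilinear_for *:%R *:%R reassoc.
Proof.
split=> [w|t] a x y; rewrite /reassoc ?linearP //=.
elim/tensW: t => [u v|s t sE tE].
  by rewrite !tlift_pure /= /cons_right !linearPr.
by rewrite !linearD /= sE tE addrACA.
Qed.
HB.instance Definition _ := bilinear_isBilinear.Build K (tens U V) W
  (tens U (tens V W)) *:%R *:%R reassoc reassoc_bilinear.

(* The canonical isomorphism (U (x) V) (x) W -> U (x) (V (x) W). *)
Definition tassoc : {linear tens (tens U V) W -> tens U (tens V W)} :=
  tlift reassoc.

Lemma tassoc_pure u v w : tassoc ((u \ox v) \ox w) = u \ox (v \ox w).
Proof. by rewrite [LHS]tlift_pure [LHS]tlift_pure. Qed.

End Associator.

Section TensorAlgebra.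
Variables (K : fieldType) (A B : nualgType K).

Definition tmul_pure (a : A) (b : B) : tens A B -> tens A B :=
  tmap (lmul a) (lmul b).

Fact tmul_pure_bilinear : bilinear_for *:%R *:%R tmul_pure.
Proof.
split=> [b|a] k x y; apply/funext; elim/tensW => [u v|s t sE tE].
- by rewrite /tmul_pure /= !fctE !tmap_pure /= !lmulE !linearPl.
- by rewrite /tmul_pure /= !fctE !linearD /= addrACA; congr (_ + _).
- by rewrite /tmul_pure /= !fctE !tmap_pure /= !lmulE linearPl linearPr.
- by rewrite /tmul_pure /= !fctE !linearD /= addrACA; congr (_ + _).
Qed.
HB.instance Definition _ := bilinear_isBilinear.Build K A B
  (tens A B -> tens A B) *:%R *:%R tmul_pure tmul_pure_bilinear.

Definition tmul (s t : tens A B) : tens A B := tlift tmul_pure s t.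

Lemma tmul_pureE a b c d : tmul (a \ox b) (c \ox d) = (a ** c) \ox (b ** d).
Proof. by rewrite /tmul tlift_pure [LHS]tmap_pure. Qed.

Fact tmul_bilinear : bilinear_for *:%R *:%R tmul.
Proof.
split=> [t|s] k x y; first by rewrite /tmul linearP.
elim/tensW: s => [a b|s t sE tE]; first by rewrite /tmul tlift_pure [LHS]linearP.
rewrite /tmul !linearD /= !fctE -!/(tmul _ _) sE tE.
by rewrite scalerDr addrACA.
Qed.

Fact tmulA : associative tmul.
Proof.
have mulDl s t u : tmul (s + t) u = tmul s u + tmul t u.
  by have := tmul_bilinear.1 u 1 s t; rewrite /= !scale1r.
have mulDr s t u : tmul s (t + u) = tmul s t + tmul s u.
  by have := tmul_bilinear.2 s 1 t u; rewrite /= !scale1r.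
elim/tensW => [a a'|s s' IHs IHs'] t u; last by rewrite !mulDl IHs IHs'.
elim/tensW: t => [b b'|t t' IHt IHt']; last by rewrite !(mulDl, mulDr) IHt IHt'.
elim/tensW: u => [c c'|u u' IHu IHu']; last by rewrite !mulDr IHu IHu'.
by rewrite !tmul_pureE !nmulA.
Qed.

HB.instance Definition _ := Lmodule_isNonUnitalAlgebra.Build K (tens A B)
  tmulA tmul_bilinear.

Lemma pureM (a c : A) (b d : B) :
  (a \ox b) ** (c \ox d) = (a ** c) \ox (b ** d).
Proof. exact: tmul_pureE. Qed.

End TensorAlgebra.

Section TensorNondegenerate.
Variables (K : fieldType) (A B : nualgType K).

Lemma slice_left_map (f : {linear A -> A}) (g : {linear B -> B})
    (phi : {scalar A}) (t : tens A B) :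
  slice_left phi (tmap f g t) = g (slice_left (phi \o f : {scalar A}) t).
Proof.
elim/tensW: t => [u v|s t sE tE]; last by rewrite !linearD /= sE tE.
by rewrite tmap_pure !slice_left_pure linearZ.
Qed.

Lemma slice_swap (phi : {scalar A}) (psi : {scalar B}) (t : tens A B) :
  psi (slice_left phi t) = phi (slice_right psi t).
Proof.
elim/tensW: t => [u v|s t sE tE]; last by rewrite !linearD /= sE tE.
by rewrite slice_left_pure slice_right_pure !linearZ /= mulrC.
Qed.

Lemma slice_right_comp (f : {linear A -> A}) (phi : {scalar A})
    (psi : {scalar B}) (t : tens A B) :
  psi (slice_left (phi \o f : {scalar A}) t) = phi (f (slice_right psi t)).
Proof. exact: slice_swap. Qed.

Lemma mul_tmap_r (t : tens A B) a b :
  t ** (a \ox b) = tmap (rmul a) (rmul b) t.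
Proof.
elim/tensW: t => [u v|s t sE tE]; last by rewrite linearDl linearD /= sE tE.
by rewrite tmap_pure pureM.
Qed.

Lemma mul_tmap_l (t : tens A B) a b :
  (a \ox b) ** t = tmap (lmul a) (lmul b) t.
Proof.
elim/tensW: t => [u v|s t sE tE]; last by rewrite linearDr linearD /= sE tE.
by rewrite tmap_pure pureM.
Qed.

Lemma tens_nondegenerate :
  nondegenerate A -> nondegenerate B -> nondegenerate (tens A B).
Proof.
move=> [Al Ar] [Bl Br]; split=> t t0; apply: slice_separation => psi.
  apply: Al => a; apply: functional_separation => phi.
  rewrite -(slice_right_comp (rmul a)) -[RHS](linear0 psi); congr (psi _).
  apply: Bl => b.
  by rewrite -[LHS](slice_left_map _ (rmul b)) -mul_tmap_r t0 linear0.
apply: Ar => a; apply: functional_separation => phi.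
rewrite -(slice_right_comp (lmul a)) -[RHS](linear0 psi); congr (psi _).
apply: Br => b.
by rewrite -[LHS](slice_left_map _ (lmul b)) -mul_tmap_l t0 linear0.
Qed.

End TensorNondegenerate.

(* A multiplier x of B is recorded as the pair of its actions b |-> x b and
   b |-> b x. *)
Section Multipliers.
Variables (K : fieldType) (B : nualgType K).

Definition is_multiplier (x : (B -> B) * (B -> B)) : Prop :=
  [/\ linear x.1, linear x.2,
      forall a b, x.1 (a ** b) = x.1 a ** b,
      forall a b, x.2 (a ** b) = a ** x.2 b &
      forall a b, a ** x.1 b = x.2 a ** b].

Definition multiplier_pred : {pred (B -> B) * (B -> B)} :=
  fun x => `[< is_multiplier x >].

Fact multiplier_closed : submod_closed multiplier_pred.
Proof.
split.
  apply/asboolP; change (is_multiplier (fun=> 0, fun=> 0)).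
  by split=> /= [a x y|a x y|a b|a b|a b] //;
    rewrite ?scaler0 ?addr0 ?linear0l ?linear0r.
move=> k x y /asboolP [xl xr xA xA' xC] /asboolP [yl yr yA yA' yC].
apply/asboolP; split=> /= [a u v|a u v|a b|a b|a b]; rewrite !fctE.
- by rewrite xl yl !scalerDr !scalerA [k * a]mulrC addrACA.
- by rewrite xr yr !scalerDr !scalerA [k * a]mulrC addrACA.
- by rewrite xA yA linearPl.
- by rewrite xA' yA' linearPr.
- by rewrite linearPl linearPr /= xC yC.
Qed.
HB.instance Definition _ := GRing.isSubmodClosed.Build K
  ((B -> B) * (B -> B))%type multiplier_pred multiplier_closed.

Record multiplier := Multiplier {
  mult_val : (B -> B) * (B -> B);
  mult_valP : mult_val \in multiplier_pred }.

HB.instance Definition _ := [isSub for mult_val].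
HB.instance Definition _ := [Choice of multiplier by <:].
HB.instance Definition _ := [SubChoice_isSubLmodule of multiplier by <:].

Definition lact (x : multiplier) : B -> B := (mult_val x).1.
Definition ract (x : multiplier) : B -> B := (mult_val x).2.

Lemma multiplierP x : is_multiplier (lact x, ract x).
Proof. by case: x => [[l r] xP]; exact/asboolP/xP. Qed.

Lemma multiplier_eq x y : lact x =1 lact y -> ract x =1 ract y -> x = y.
Proof.
case: x y => [[l r] xP] [[l' r'] yP]; rewrite /lact /ract /= => /funext ll'.
by move=> /funext rr'; apply: val_inj; rewrite /= ll' rr'.
Qed.

Definition mk_multiplier l r (lrP : is_multiplier (l, r)) : multiplier :=
  Multiplier (asboolT lrP).

HB.instance Definition _ x := GRing.isLinear.Build K B B *:%R (lact x)
  (let: And5 h _ _ _ _ := multiplierP x in h).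
HB.instance Definition _ x := GRing.isLinear.Build K B B *:%R (ract x)
  (let: And5 _ h _ _ _ := multiplierP x in h).

Lemma lactM x a b : lact x (a ** b) = lact x a ** b.
Proof. by case: (multiplierP x) => _ _ + _ _; apply. Qed.
Lemma ractM x a b : ract x (a ** b) = a ** ract x b.
Proof. by case: (multiplierP x) => _ _ _ + _; apply. Qed.
Lemma lractC x a b : a ** lact x b = ract x a ** b.
Proof. by case: (multiplierP x) => _ _ _ _; apply. Qed.

Fact mult_one_subproof : is_multiplier (id, id).
Proof. by split. Qed.
Definition mult_one := mk_multiplier mult_one_subproof.

Fact mult_mul_subproof x y :
  is_multiplier (lact x \o lact y, ract y \o ract x).
Proof.
split=> /= [a u v|a u v|a b|a b|a b]; rewrite ?linearP //.
- by rewrite !lactM.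
- by rewrite !ractM.
- by rewrite !lractC.
Qed.
Definition mult_mul x y := mk_multiplier (mult_mul_subproof x y).

Lemma lactD x y b : lact (x + y) b = lact x b + lact y b. Proof. by []. Qed.
Lemma ractD x y b : ract (x + y) b = ract x b + ract y b. Proof. by []. Qed.
Lemma lactZ k x b : lact (k *: x) b = k *: lact x b. Proof. by []. Qed.
Lemma ractZ k x b : ract (k *: x) b = k *: ract x b. Proof. by []. Qed.

Fact mult_mulA : associative mult_mul.
Proof. by move=> x y z; apply: multiplier_eq. Qed.
Fact mult_mul1 : left_id mult_one mult_mul.
Proof. by move=> x; apply: multiplier_eq. Qed.
Fact mult_mulr1 : right_id mult_one mult_mul.
Proof. by move=> x; apply: multiplier_eq. Qed.
Fact mult_mulDl : left_distributive mult_mul +%R.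
Proof.
move=> x y z; apply: multiplier_eq => b //.
by rewrite ractD /ract /= -!/(ract _ _) -linearD.
Qed.
Fact mult_mulDr : right_distributive mult_mul +%R.
Proof.
move=> x y z; apply: multiplier_eq => b //.
by rewrite lactD /lact /= -!/(lact _ _) -linearD.
Qed.
HB.instance Definition _ := GRing.Zmodule_isPzRing.Build multiplier
  mult_mulA mult_mul1 mult_mulr1 mult_mulDl mult_mulDr.

Fact to_mult_subproof b : is_multiplier (lmul b, rmul b).
Proof.
split=> /= [a u v|a u v|u v|u v|u v]; rewrite ?linearP // ?lmulE ?rmulE //;
  by rewrite nmulA.
Qed.

(* The canonical map B -> M(B); it is injective when B is non-degenerate. *)
Definition to_mult (b : B) : multiplier :=
  mk_multiplier (to_mult_subproof b).

Fact to_mult_linear : linear to_mult.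
Proof.
by move=> k x y; apply: multiplier_eq => b;
  rewrite ?lactD ?ractD ?lactZ ?ractZ; [exact: linearPl|exact: linearPr].
Qed.
HB.instance Definition _ := GRing.isLinear.Build K B multiplier *:%R
  to_mult to_mult_linear.

Lemma to_mult_inj : nondegenerate B -> injective to_mult.
Proof.
move=> [Bl _] x y xy; apply/eqP; rewrite -subr_eq0; apply/eqP/Bl => b.
rewrite linearBl; apply/eqP; rewrite subr_eq0; apply/eqP.
exact: (congr1 (fun z => lact z b) xy).
Qed.

Lemma lact_mul x y b : lact (x * y) b = lact x (lact y b).
Proof. by []. Qed.
Lemma ract_mul x y b : ract (x * y) b = ract y (ract x b).
Proof. by []. Qed.

Lemma mult_scaleAl (k : K) (x y : multiplier) : (k *: x) * y = k *: (x * y).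
Proof.
apply: multiplier_eq => b; first by rewrite lactZ !lact_mul lactZ.
by rewrite ractZ !ract_mul ractZ linearZ_LR.
Qed.

Lemma mult_scaleAr (k : K) (x y : multiplier) : x * (k *: y) = k *: (x * y).
Proof.
apply: multiplier_eq => b; first by rewrite lactZ !lact_mul lactZ linearZ_LR.
by rewrite ractZ !ract_mul ractZ.
Qed.

Lemma mul_to_mult b x : to_mult b * x = to_mult (ract x b).
Proof.
by apply: multiplier_eq => c; [exact: lractC|exact: ractM].
Qed.

Lemma to_multM b c : to_mult (b ** c) = to_mult b * to_mult c.
Proof. by rewrite mul_to_mult. Qed.

End Multipliers.

Section TensorMultipliers.
Variables (K : fieldType) (B D : nualgType K).

Fact mtens_subproof (x : multiplier B) (y : multiplier D) :
  is_multiplier (tmap (lact x) (lact y) : tens B D -> tens B D,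
                 tmap (ract x) (ract y) : tens B D -> tens B D).
Proof.
split=> [a u v|a u v|s t|s t|s t]; cbn [fst snd]; rewrite ?linearP //;
  elim/tensW: s => [b d|s s' sE sE'].
- elim/tensW: t => [b' d'|t t' tE tE']; last first.
    by rewrite nmulDr tmapD tE tE' nmulDr.
  by rewrite pureM !tmap_pure pureM /= !lactM.
- by rewrite nmulDl !tmapD nmulDl sE sE'.
- elim/tensW: t => [b' d'|t t' tE tE']; last first.
    by rewrite nmulDr tmapD tE tE' tmapD nmulDr.
  by rewrite pureM !tmap_pure pureM /= !ractM.
- by rewrite nmulDl tmapD sE sE' nmulDl.
- elim/tensW: t => [b' d'|t t' tE tE']; last first.
    by rewrite tmapD !nmulDr tE tE'.
  by rewrite !tmap_pure !pureM /= !lractC.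
- by rewrite tmapD !nmulDl sE sE'.
Qed.

(* The multiplier x (x) y of B (x) D. *)
Definition mtens (x : multiplier B) (y : multiplier D) :
    multiplier (tens B D) :=
  mk_multiplier (mtens_subproof x y).

Fact mtens_bilinear : bilinear_for *:%R *:%R mtens.
Proof.
split=> [z|z] k x y; apply: multiplier_eq; elim/tensW => [b d|s t sE tE];
  try (by rewrite !linearD /= sE tE).
- by rewrite lactD lactZ ![lact (mtens _ _) _]tmap_pure linearPl.
- by rewrite ractD ractZ ![ract (mtens _ _) _]tmap_pure linearPl.
- by rewrite lactD lactZ ![lact (mtens _ _) _]tmap_pure linearPr.
- by rewrite ractD ractZ ![ract (mtens _ _) _]tmap_pure linearPr.
Qed.
HB.instance Definition _ := bilinear_isBilinear.Build K (multiplier B)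
  (multiplier D) (multiplier (tens B D)) *:%R *:%R mtens mtens_bilinear.

Lemma mtens_to_mult b d :
  mtens (to_mult b) (to_mult d) = to_mult (b \ox d).
Proof.
apply: multiplier_eq => t.
  by rewrite [RHS](mul_tmap_l t).
by rewrite [RHS](mul_tmap_r t).
Qed.

Lemma mtens_mul x x' y y' :
  mtens (x * x') (y * y') = mtens x y * mtens x' y'.
Proof.
apply: multiplier_eq; elim/tensW => [b d|s t sE tE];
  try (by rewrite !linearD /= sE tE);
  by rewrite [LHS]tmap_pure [RHS]/= [X in _ = tmap _ _ X]tmap_pure [RHS]tmap_pure.
Qed.

End TensorMultipliers.

Section TensorMultiplierMap.
Variables (K : fieldType) (U V : lmodType K) (B D : nualgType K).

Definition pure_mtens (f : {linear U -> multiplier B})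
  (g : {linear V -> multiplier D}) u v := mtens (f u) (g v).

Fact pure_mtens_bilinear f g : bilinear_for *:%R *:%R (pure_mtens f g).
Proof.
by split=> [v|u] a x y; rewrite /pure_mtens linearP ?linearPl ?linearPr.
Qed.
HB.instance Definition _ f g := bilinear_isBilinear.Build K U V
  (multiplier (tens B D)) *:%R *:%R (pure_mtens f g) (pure_mtens_bilinear f g).

(* The map f (x) g : U (x) V -> M(B (x) D), for f : U -> M(B) and
   g : V -> M(D). *)
Definition mtens_map (f : {linear U -> multiplier B})
    (g : {linear V -> multiplier D}) :
  {linear tens U V -> multiplier (tens B D)} := tlift (pure_mtens f g).

End TensorMultiplierMap.

(* The preimage of y under f, and 0 when there is none. *)
Definition preimage0 (X : zmodType) (Y : Type) (f : X -> Y) (y : Y) : X :=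
  xget 0 [set x | f x = y].

Lemma preimage0P (X : zmodType) (Y : Type) (f : X -> Y) (y : Y) :
  (exists x, f x = y) -> f (preimage0 f y) = y.
Proof. exact: (@xgetPex X 0 [set x | f x = y]). Qed.

Section Comultiplication.
Variables (K : fieldType) (A : nualgType K).
Variable Delta : {linear A -> multiplier (tens A A)}.

Definition delta1 (a b : A) : multiplier (tens A A) :=
  Delta a * mtens 1 (to_mult b).
Definition delta4 (c a : A) : multiplier (tens A A) :=
  Delta a * mtens (to_mult c) 1.

Fact delta1_bilinear : bilinear_for *:%R *:%R delta1.
Proof.
split=> [b|a] k x y; rewrite /delta1 linearP.
  by rewrite mulrDl mult_scaleAl.
by rewrite linearPr mulrDr mult_scaleAr.
Qed.
HB.instance Definition _ := bilinear_isBilinear.Build K A A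
  (multiplier (tens A A)) *:%R *:%R delta1 delta1_bilinear.

Fact delta4_bilinear : bilinear_for *:%R *:%R delta4.
Proof.
split=> [a|c] k x y; rewrite /delta4 linearP.
  by rewrite linearPl mulrDr mult_scaleAr.
by rewrite mulrDl mult_scaleAl.
Qed.
HB.instance Definition _ := bilinear_isBilinear.Build K A A
  (multiplier (tens A A)) *:%R *:%R delta4 delta4_bilinear.

(* The linear maps a (x) b |-> Delta(a)(1 (x) b) and
   c (x) a |-> Delta(a)(c (x) 1), with values in M(A (x) A). *)
Definition T1_mult : {linear tens A A -> multiplier (tens A A)} :=
  tlift delta1.
Definition T4_mult : {linear tens A A -> multiplier (tens A A)} :=
  tlift delta4.

(* The same maps with values in A (x) A; meaningful once the range of
   T1_mult, resp. T4_mult, is contained in A (x) A. *)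
Definition T1 (t : tens A A) : tens A A := preimage0 (@to_mult K _) (T1_mult t).
Definition T4 (t : tens A A) : tens A A := preimage0 (@to_mult K _) (T4_mult t).

(* x in M((A (x) A) (x) A) and y in M(A (x) (A (x) A)) are the same multiplier
   of A (x) A (x) A. *)
Definition same_multiplier (x : multiplier (tens (tens A A) A))
    (y : multiplier (tens A (tens A A))) : Prop :=
  forall t, tassoc _ _ _ (lact x t) = lact y (tassoc _ _ _ t) /\
            tassoc _ _ _ (ract x t) = ract y (tassoc _ _ _ t).

Definition coassociative : Prop := forall a b c : A,
  same_multiplier
    (mtens_map Delta (@to_mult K A) (T1 (a \ox b))
       * mtens (mtens (to_mult c) 1) 1)
    (mtens_map (@to_mult K A) Delta (T4 (c \ox a))
       * mtens 1 (mtens 1 (to_mult b))).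

Record is_left_multiplier_Hopf : Prop := IsLeftMultiplierHopf {
  lmH_nondegenerate : nondegenerate A;
  lmH_comultM : forall a b, Delta (a ** b) = Delta a * Delta b;
  lmH_T1_range : forall t, exists s, to_mult s = T1_mult t;
  lmH_T4_range : forall t, exists s, to_mult s = T4_mult t;
  lmH_coassociative : coassociative;
  lmH_T1_bijective : bijective T1;
  lmH_T4_bijective : bijective T4 }.

End Comultiplication.

Record left_multiplier_Hopf (K : fieldType) (A : nualgType K) :=
  LeftMultiplierHopf {
    comult :> {linear A -> multiplier (tens A A)};
    comultP : is_left_multiplier_Hopf comult }.

(* The algebra L(A). *)
Record left_multiplier (K : fieldType) (A : nualgType K) := LeftMultiplier {
  left_act :> {linear A -> A};
  left_actM : forall a b, left_act (a ** b) = left_act a ** b }.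

Section LeftMultiplierHopf.
Variables (K : fieldType) (A : nualgType K) (H : left_multiplier_Hopf A).

Definition T1_inv : tens A A -> tens A A := preimage0 (T1 H).
Definition T4_inv : tens A A -> tens A A := preimage0 (T4 H).

Lemma T1E t : to_mult (T1 H t) = T1_mult H t.
Proof. exact/preimage0P/(lmH_T1_range (comultP H)). Qed.

Lemma T4E t : to_mult (T4 H t) = T4_mult H t.
Proof. exact/preimage0P/(lmH_T4_range (comultP H)). Qed.

Let AA_inj : injective (@to_mult K (tens A A)).
Proof.
by have ndA := lmH_nondegenerate (comultP H);
  exact/to_mult_inj/tens_nondegenerate.
Qed.

Fact T1_linear : linear (T1 H).
Proof. by move=> k s t; apply: AA_inj; rewrite T1E linearP linearP -!T1E. Qed.

Fact T4_linear : linear (T4 H).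
Proof. by move=> k s t; apply: AA_inj; rewrite T4E linearP linearP -!T4E. Qed.

Lemma T1_invK : cancel T1_inv (T1 H).
Proof.
move=> t; apply: preimage0P.
by have [g _ gK] := lmH_T1_bijective (comultP H); exists (g t).
Qed.

Lemma T4_invK : cancel T4_inv (T4 H).
Proof.
move=> t; apply: preimage0P.
by have [g _ gK] := lmH_T4_bijective (comultP H); exists (g t).
Qed.

Lemma T1K : cancel (T1 H) T1_inv.
Proof.
by move=> t; apply: (bij_inj (lmH_T1_bijective (comultP H))); rewrite T1_invK.
Qed.

Lemma T4K : cancel (T4 H) T4_inv.
Proof.
by move=> t; apply: (bij_inj (lmH_T4_bijective (comultP H))); rewrite T4_invK.
Qed.

Fact T1_inv_linear : linear T1_inv.
Proof.
move=> k s t; apply: (bij_inj (lmH_T1_bijective (comultP H))).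
by rewrite T1_invK T1_linear !T1_invK.
Qed.
HB.instance Definition _ := GRing.isLinear.Build K (tens A A) (tens A A) *:%R
  T1_inv T1_inv_linear.

Fact T4_inv_linear : linear T4_inv.
Proof.
move=> k s t; apply: (bij_inj (lmH_T4_bijective (comultP H))).
by rewrite T4_invK T4_linear !T4_invK.
Qed.
HB.instance Definition _ := GRing.isLinear.Build K (tens A A) (tens A A) *:%R
  T4_inv T4_inv_linear.

Definition is_counit (eps : {scalar A}) : Prop :=
  forall a b, eps a *: b = tlift (@nmul K A) (T1_inv (a \ox b)).

Section Antipodes.
Variable eps : {scalar A}.

Definition antipode_fun (a b : A) : A := slice_left eps (T1_inv (a \ox b)).
Definition antipode'_fun (a c : A) : A := slice_right eps (T4_inv (c \ox a)).

Fact antipode_linear a : linear (antipode_fun a).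
Proof. by move=> k x y; rewrite /antipode_fun linearPr !linearP. Qed.
Fact antipode'_linear a : linear (antipode'_fun a).
Proof. by move=> k x y; rewrite /antipode'_fun linearPl !linearP. Qed.
HB.instance Definition _ a := GRing.isLinear.Build K A A *:%R
  (antipode_fun a) (antipode_linear a).
HB.instance Definition _ a := GRing.isLinear.Build K A A *:%R
  (antipode'_fun a) (antipode'_linear a).

Lemma T1_ract (d : A) (s : tens A A) :
  T1 H (ract (mtens 1 (to_mult d)) s) = ract (mtens 1 (to_mult d)) (T1 H s).
Proof.
apply: AA_inj; rewrite T1E -mul_to_mult T1E.
elim/tensW: s => [p b|s t sE tE]; last by rewrite !linearD mulrDl sE tE.
rewrite [ract _ _]tmap_pure [LHS]tlift_pure [T1_mult _ _]tlift_pure.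
rewrite /delta1 -mulrA; congr (_ * _).
by rewrite -mtens_mul mulr1 -to_multM.
Qed.

Lemma T4_ract (d : A) (s : tens A A) :
  T4 H (ract (mtens (to_mult d) 1) s) = ract (mtens (to_mult d) 1) (T4 H s).
Proof.
apply: AA_inj; rewrite T4E -mul_to_mult T4E.
elim/tensW: s => [c a|s t sE tE]; last by rewrite !linearD mulrDl sE tE.
rewrite [ract _ _]tmap_pure [LHS]tlift_pure [T4_mult _ _]tlift_pure.
rewrite /delta4 -mulrA; congr (_ * _).
by rewrite -mtens_mul mulr1 -to_multM.
Qed.

Fact antipode_actM a b d :
  antipode_fun a (b ** d) = antipode_fun a b ** d.
Proof.
rewrite /antipode_fun; set s := T1_inv (a \ox b).
have -> : T1_inv (a \ox (b ** d)) = ract (mtens 1 (to_mult d)) s.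
  apply: (bij_inj (lmH_T1_bijective (comultP H))).
  by rewrite T1_ract !T1_invK [RHS]tmap_pure.
elim/tensW: s => [u v|s t sE tE]; last by rewrite !linearD sE tE linearDl.
by rewrite [ract _ _]tmap_pure !slice_left_pure linearZl_LR.
Qed.

Fact antipode'_actM a c d :
  antipode'_fun a (c ** d) = antipode'_fun a c ** d.
Proof.
rewrite /antipode'_fun; set s := T4_inv (c \ox a).
have -> : T4_inv ((c ** d) \ox a) = ract (mtens (to_mult d) 1) s.
  apply: (bij_inj (lmH_T4_bijective (comultP H))).
  by rewrite T4_ract !T4_invK [RHS]tmap_pure.
elim/tensW: s => [u v|s t sE tE]; last by rewrite !linearD sE tE linearDl.
by rewrite [ract _ _]tmap_pure !slice_right_pure linearZl_LR.
Qed.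

(* The maps S and S' from A to L(A). *)
Definition antipode (a : A) : left_multiplier A :=
  @LeftMultiplier K A (antipode_fun a) (antipode_actM a).
Definition antipode' (a : A) : left_multiplier A :=
  @LeftMultiplier K A (antipode'_fun a) (antipode'_actM a).

End Antipodes.

End LeftMultiplierHopf.

(* Main.v *)
(* Reading Sweedler's notation off the definitions, the first sum is
   (eps (x) id)(T1^-1 (T1 (a (x) b))) and the second is
   (id (x) eps)(T4^-1 (T4 (c (x) a))). *)
Require Import Defs.
From mathcomp Require Import all_boot all_algebra.
From mathcomp Require Import reals complex.

Set Implicit Arguments.
Unset Strict Implicit.
Unset Printing Implicit Defensive.

Import GRing.Theory.
Local Open Scope ring_scope.
Local Open Scope complex_scope.

(** [S] is built from [T1_inv], and the Sweedler legs of [a] come from [T1]. Summing [S] over the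
    legs therefore cancels [T1_inv] against [T1] and leaves the [eps]-slice of [a \ox b]. The second
    identity is the mirror image, with [T4] and the right slice. *)

(** Non-degeneracy makes [to_mult] injective on [tens A A], so an identity between multipliers
    determines the tensor [T1 H (a \ox b)], whichever decomposition is used. *)
Lemma T1_pure (K : fieldType) (A : nualgType K) (H : left_multiplier_Hopf A)
    (a b : A) (t : tens A A) :
  comult H a * mtens 1 (to_mult b) = to_mult t -> T1 H (a \ox b) = t.
Proof.
have [ndA _ _ _ _ _ _] := comultP H => Delta_t.
apply: (to_mult_inj (tens_nondegenerate ndA ndA)).
by rewrite T1E [LHS]tlift_pure.
Qed.

Lemma T4_pure (K : fieldType) (A : nualgType K) (H : left_multiplier_Hopf A)
    (c a : A) (t : tens A A) :
  comult H a * mtens (to_mult c) 1 = to_mult t -> T4 H (c \ox a) = t.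
Proof.
have [ndA _ _ _ _ _ _] := comultP H => Delta_t.
apply: (to_mult_inj (tens_nondegenerate ndA ndA)).
by rewrite T4E [LHS]tlift_pure.
Qed.

Theorem proposition4p3 (R : realType) (A : nualgType R[i])
    (H : left_multiplier_Hopf A) (eps : {scalar A}) (eps_counit : is_counit H eps)
    (a b c : A) :
  (forall (n : nat) (p q : 'I_n -> A),
     comult H a * mtens 1 (to_mult b) = to_mult (\sum_(i < n) p i \ox q i) ->
     \sum_(i < n) antipode H eps (p i) (q i) = eps a *: b) /\
  (forall (n : nat) (p q : 'I_n -> A),
     comult H a * mtens (to_mult c) 1 = to_mult (\sum_(i < n) p i \ox q i) ->
     \sum_(i < n) antipode' H eps (q i) (p i) = eps a *: c).
Proof.
split=> n p q Delta_pq.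
  rewrite -slice_left_pure -(T1K H (a \ox b)) (T1_pure Delta_pq) !linear_sum.
  (* Termwise, [antipode H eps (p i) (q i)] is by definition the slice of
     [T1_inv H (p i \ox q i)]. *)
  by apply: eq_bigr.
rewrite -slice_right_pure -(T4K H (c \ox a)) (T4_pure Delta_pq) !linear_sum.
by apply: eq_bigr.
Qed.
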